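(* Let $(\mathcal C,\mathcal E,A,\widehat{\deg},\mathrm{rk})$ be a Harder-Narasimhan category. If $(X,h)$ is a non-zero arithmetic object, then there exists a sequence of admissible monomorphisms in $\mathcal C$ $$0=X_0\to X_1\to\cdots\to X_{n-1}\to X_n=X,$$ unique up to a unique isomorphism, such that, if for every integer $0\le i\le n$ we denote by $h_i\in A(X_i)$ the arithmetic structure induced from $h$ (via the composed admissible monomorphism $X_i\to X$), and if for every integer $1\le j\le n$ we denote by $\overline{X_j/X_{j-1}}$ the object $X_j/X_{j-1}$ equipped with the quotient arithmetic structure of $h_j$, then: 1) for every integer $1\le j\le n$, the arithmetic object $\overline{X_j/X_{j-1}}$ is semistable; 2) $\widehat\mu(\overline{X_1/X_0})>\widehat\mu(\overline{X_2/X_1})>\cdots>\widehat\mu(\overline{X_n/X_{n-1}})$.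
   Context: Exact categories. An exact category $(\mathcal C,\mathcal E)$ is an exact category in the sense of Quillen with $\mathcal C$ essentially small, $\mathcal E$ being its class of distinguished short exact sequences $0\to X'\to X\to X''\to 0$. A morphism occurring as $X'\to X$ (resp. $X\to X''$) in such a sequence is an admissible monomorphism (resp. admissible epimorphism); the cokernel of an admissible monomorphism $X\to Y$ is denoted $Y/X$; $X\amalg Y$ is the direct sum. Arithmetic exact categories. An arithmetic structure $A$ on $(\mathcal C,\mathcal E)$ consists of a set $A(X)$ for every object $X$, a map $f^*:A(Y)\to A(X)$ for every admissible monomorphism $f:X\to Y$, and a map $g_*:A(X)\to A(Y)$ for every admissible epimorphism $g:X\to Y$, such that: (A1) $A(0)$ is a one-point set; (A2) $(ji)^*=i^*j^*$ for composable admissible monomorphisms $i,j$; (A3) $(qp)_*=q_*p_*$ for composable admissible epimorphisms $p,q$; (A4) $\mathrm{Id}_X^*=\mathrm{Id}_{X*}=\mathrm{Id}_{A(X)}$; (A5) if $f:X\to Y$ is an isomorphism then $f^*f_*=\mathrm{Id}_{A(X)}$ and $f_*f^*=\mathrm{Id}_{A(Y)}$; (A6) for every cartesian or cocartesian square with $u:X\to Y$, $v:Z\to W$ admissible monomorphisms, $p:X\to Z$, $q:Y\to W$ admissible epimorphisms and $qu=vp$, one has $v^*q_*=p_*u^*$; (A7) if $u:X\to Y$ is an admissible epimorphism, $v:Y\to Z$ an admissible monomorphism and $(h_X,h_Z)\in A(X)\times A(Z)$ satisfies $u_*(h_X)=v^*(h_Z)$, then there is $h\in A(X\amalg Z)$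 with $(\mathrm{Id},vu)^*(h)=h_X$ and $\mathrm{pr}_{2*}(h)=h_Z$. Then $(\mathcal C,\mathcal E,A)$ is called an arithmetic exact category; an arithmetic object is a pair $\overline X=(X,h)$ with $h\in A(X)$, and it is non-zero if $X\ne0$. For an admissible monomorphism $i:Y\to X$, $i^*h$ is the induced structure and $(Y,i^*h)$ is an arithmetic subobject of $(X,h)$; for an admissible epimorphism $p:X\to Z$, $p_*h$ is the quotient structure and $(Z,p_*h)$ is an arithmetic quotient of $(X,h)$. A morphism $f:X'\to X''$ of $\mathcal C$ is compatible with arithmetic structures $h'\in A(X')$, $h''\in A(X'')$ if there are an arithmetic object $(X,h)$, an admissible monomorphism $u:X'\to X$ and an admissible epimorphism $v:X\to X''$ with $f=vu$, $h'=u^*(h)$, $h''=v_*(h)$. Arithmetic objects and compatible morphisms form a category $\mathcal C_A$. Degree, rank, slope. $\mathcal E_A$ is the class of diagrams $0\to(X',h')\xrightarrow{i}(X,h)\xrightarrow{p}(X'',h'')\to0$ with underlying sequence in $\mathcal E$, $h'=i^*h$, $h''=p_*h$. $K_0(\mathcal C,\mathcal E,A)$ is the free abelian group on isomorphism classes of $\mathcal C_A$ modulo the relations $[(X,h)]=[(X',h')]+[(X'',h'')]$ for diagrams in $\mathcal E_A$; $K_0(\mathcal C,\mathcal E)$ is the usual Grothendieck group. A degree function is a group homomorphism $\widehat{\deg}:K_0(\mathcal C,\mathcal E,A)\to\mathbb R$; a rank function is a group homomorphism $\mathrm{rk}:K_0(\mathcal C,\mathcal E)\to\mathbb Z$ with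 $\mathrm{rk}([X])>0$ for $X\neq0$. For a non-zero arithmetic object, $\widehat\mu(X,h)=\widehat{\deg}(X,h)/\mathrm{rk}(X)$; it is semistable if $\widehat\mu(X',h')\le\widehat\mu(X,h)$ for every non-zero arithmetic subobject $(X',h')$. Harder-Narasimhan category. $(\mathcal C,\mathcal E,A,\widehat{\deg},\mathrm{rk})$ is a Harder-Narasimhan category if: (HN1) every non-zero arithmetic object $(X,h)$ has a (non-zero) arithmetic subobject $(X_{\mathrm{des}},h_{\mathrm{des}})$ whose slope equals $\sup\{\widehat\mu(X',h'):(X',h')\text{ a non-zero arithmetic subobject of }(X,h)\}$, and for every non-zero arithmetic subobject $(X_0,h_0)$ of $(X,h)$ with $\widehat\mu(X_0,h_0)=\widehat\mu(X_{\mathrm{des}},h_{\mathrm{des}})$ there is an admissible monomorphism $f:X_0\to X_{\mathrm{des}}$, commuting with the inclusions into $X$, such that $f^*(h_{\mathrm{des}})=h_0$; (HN2) if $(X_1,h_1)$, $(X_2,h_2)$ are semistable with $\widehat\mu(X_1,h_1)>\widehat\mu(X_2,h_2)$, there is no non-zero morphism $X_1\to X_2$ compatible with arithmetic structures. *)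

(* Defs.v *)
From HB Require Import structures.
From mathcomp Require Import all_boot all_order all_algebra.
From mathcomp Require Import boolp classical_sets reals.
From mathcomp Require Import freeg.

Set Implicit Arguments.
Unset Strict Implicit.
Unset Printing Implicit Defensive.

Import Order.TTheory GRing.Theory Num.Theory.
Local Open Scope ring_scope.

(** * Additive categories *)

(* Morphism groups are [zmodType]s; under the classical axioms of [boolp] every
   abelian group carries that structure.  A zero object and a direct sum of any
   two objects are chosen. Essential smallness is implicit in [obj : Type]. *)
Record additive_category := AdditiveCategory {
  obj :> Type;
  mor : obj -> obj -> zmodType;
  idm : forall X, mor X X;
  mcomp : forall X Y Z, mor Y Z -> mor X Y -> mor X Z;
  mcompA : forall X Y Z W (f : mor X Y) (g : mor Y Z) (k : mor Z W),
    mcomp k (mcomp g f) = mcomp (mcomp k g) f;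
  mcomp1m : forall X Y (f : mor X Y), mcomp (idm Y) f = f;
  mcompm1 : forall X Y (f : mor X Y), mcomp f (idm X) = f;
  mcompDl : forall X Y Z (g g' : mor Y Z) (f : mor X Y),
    mcomp (g + g') f = mcomp g f + mcomp g' f;
  mcompDr : forall X Y Z (g : mor Y Z) (f f' : mor X Y),
    mcomp g (f + f') = mcomp g f + mcomp g f';
  zobj : obj;
  mor_to_zobj : forall X (f : mor X zobj), f = 0;
  mor_from_zobj : forall X (f : mor zobj X), f = 0;
  dsum : obj -> obj -> obj;
  inl_ : forall X Y, mor X (dsum X Y);
  inr_ : forall X Y, mor Y (dsum X Y);
  pr1 : forall X Y, mor (dsum X Y) X;
  pr2 : forall X Y, mor (dsum X Y) Y;
  pr1_inl : forall X Y, mcomp (pr1 X Y) (inl_ X Y) = idm X;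
  pr2_inl : forall X Y, mcomp (pr2 X Y) (inl_ X Y) = 0;
  pr1_inr : forall X Y, mcomp (pr1 X Y) (inr_ X Y) = 0;
  pr2_inr : forall X Y, mcomp (pr2 X Y) (inr_ X Y) = idm Y;
  dsum_idm : forall X Y,
    mcomp (inl_ X Y) (pr1 X Y) + mcomp (inr_ X Y) (pr2 X Y) = idm (dsum X Y)
}.

Arguments idm {_}.
Arguments mcomp {_ _ _ _}.
Arguments zobj {_}.
Arguments dsum {_}.
Arguments inl_ {_}.
Arguments inr_ {_}.
Arguments pr1 {_}.
Arguments pr2 {_}.

Notation "g \oc f" := (mcomp g f) (at level 40, left associativity).

Section AdditiveNotions.
Variable C : additive_category.

Definition is_iso (X Y : C) (f : mor X Y) : Prop :=
  exists g : mor Y X, g \oc f = idm X /\ f \oc g = idm Y.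

Definition isomorphic (X Y : C) : Prop := exists f : mor X Y, is_iso f.

Definition nonzero (X : C) : Prop := ~ isomorphic X zobj.

Definition eqmor (X Y : C) (e : X = Y) : mor X Y :=
  match e in _ = Z return mor X Z with erefl => idm X end.

(* The morphism (f, g) : T -> X (+) Y. *)
Definition pairm (T X Y : C) (f : mor T X) (g : mor T Y) : mor T (dsum X Y) :=
  inl_ X Y \oc f + inr_ X Y \oc g.

Definition is_kernel (K X Y : C) (i : mor K X) (p : mor X Y) : Prop :=
  p \oc i = 0 /\
  forall T (a : mor T X), p \oc a = 0 -> exists! t : mor T K, i \oc t = a.

Definition is_cokernel (X Y Q : C) (p : mor Y Q) (i : mor X Y) : Prop :=
  p \oc i = 0 /\
  forall T (a : mor Y T), a \oc i = 0 -> exists! t : mor Q T, t \oc p = a.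

(* Squares        u
              X ----> Y
            p |       | q
              v       v
              Z ----> W
                  v                     *)
Definition cartesian (X Y Z W : C)
    (u : mor X Y) (p : mor X Z) (q : mor Y W) (v : mor Z W) : Prop :=
  q \oc u = v \oc p /\
  forall T (a : mor T Y) (b : mor T Z), q \oc a = v \oc b ->
    exists! t : mor T X, u \oc t = a /\ p \oc t = b.

Definition cocartesian (X Y Z W : C)
    (u : mor X Y) (p : mor X Z) (q : mor Y W) (v : mor Z W) : Prop :=
  q \oc u = v \oc p /\
  forall T (a : mor Y T) (b : mor Z T), a \oc u = b \oc p ->
    exists! t : mor W T, t \oc q = a /\ t \oc v = b.

End AdditiveNotions.

Arguments eqmor {C X Y}.

(** * Quillen exact categories *)

Section Admissible.
Variable C : additive_category.
Variable E : forall X' X X'' : C, mor X' X -> mor X X'' -> Prop.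

Definition adm_mono_for (X' X : C) (i : mor X' X) : Prop :=
  exists (X'' : C) (p : mor X X''), E i p.

Definition adm_epi_for (X X'' : C) (p : mor X X'') : Prop :=
  exists (X' : C) (i : mor X' X), E i p.

End Admissible.

Record exact_category := ExactCategory {
  acat :> additive_category;
  ses : forall X' X X'' : acat, mor X' X -> mor X X'' -> Prop;
  ses_iso : forall (X' X X'' Y' Y Y'' : acat)
    (i : mor X' X) (p : mor X X'') (j : mor Y' Y) (q : mor Y Y'')
    (a : mor X' Y') (b : mor X Y) (c : mor X'' Y''),
    is_iso a -> is_iso b -> is_iso c ->
    j \oc a = b \oc i -> q \oc b = c \oc p -> ses i p -> ses j q;
  ses_split : forall X Y : acat, ses (inl_ X Y) (pr2 X Y);
  ses_kernel : forall (X' X X'' : acat) (i : mor X' X) (p : mor X X''),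
    ses i p -> is_kernel i p;
  ses_cokernel : forall (X' X X'' : acat) (i : mor X' X) (p : mor X X''),
    ses i p -> is_cokernel p i;
  adm_mono_comp_ax : forall (X Y Z : acat) (i : mor X Y) (j : mor Y Z),
    adm_mono_for ses i -> adm_mono_for ses j -> adm_mono_for ses (j \oc i);
  adm_epi_comp_ax : forall (X Y Z : acat) (p : mor X Y) (q : mor Y Z),
    adm_epi_for ses p -> adm_epi_for ses q -> adm_epi_for ses (q \oc p);
  adm_mono_pushout_ax : forall (X Y Z : acat) (u : mor X Y) (p : mor X Z),
    adm_mono_for ses u ->
    exists (W : acat) (q : mor Y W) (v : mor Z W),
      cocartesian u p q v /\ adm_mono_for ses v;
  adm_epi_pullback_ax : forall (Y Z W : acat) (q : mor Y W) (v : mor Z W),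
    adm_epi_for ses q ->
    exists (X : acat) (u : mor X Y) (p : mor X Z),
      cartesian u p q v /\ adm_epi_for ses p;
  adm_epi_cancel_ax : forall (X Y Z : acat) (g : mor X Y) (p : mor Y Z),
    (exists (K : acat) (k : mor K Y), is_kernel k p) ->
    adm_epi_for ses (p \oc g) -> adm_epi_for ses p;
  adm_mono_cancel_ax : forall (X Y Z : acat) (i : mor X Y) (g : mor Y Z),
    (exists (Q : acat) (q : mor Y Q), is_cokernel q i) ->
    adm_mono_for ses (g \oc i) -> adm_mono_for ses i
}.

Definition adm_mono (C : exact_category) (X Y : C) (i : mor X Y) : Prop :=
  adm_mono_for (@ses C) i.

Definition adm_epi (C : exact_category) (X Y : C) (p : mor X Y) : Prop :=
  adm_epi_for (@ses C) p.

Section ExactFacts.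
Variable C : exact_category.

Lemma is_iso_idm (X : C) : is_iso (idm X).
Proof. by exists (idm X); rewrite mcomp1m. Qed.

Lemma adm_mono_comp (X Y Z : C) (i : mor X Y) (j : mor Y Z) :
  adm_mono i -> adm_mono j -> adm_mono (j \oc i).
Proof. exact: adm_mono_comp_ax. Qed.

Lemma adm_mono_idm (X : C) : adm_mono (idm X).
Proof.
exists zobj, 0.
apply: (ses_iso (is_iso_idm X) (b := pr1 X zobj) _ (is_iso_idm zobj) _ _
          (ses_split X zobj)).
- exists (inl_ X zobj); split; last exact: pr1_inl.
  rewrite -(dsum_idm X zobj) (mor_from_zobj (inr_ X zobj)).
  suff -> : (0 : mor zobj (dsum X zobj)) \oc pr2 X zobj = 0 by rewrite addr0.
  by apply: (addIr (0 \oc pr2 X zobj)); rewrite -mcompDl !add0r.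
- by rewrite mcompm1 pr1_inl.
- by rewrite (mor_to_zobj (0 \oc _)) (mor_to_zobj (_ \oc _)).
Qed.

Lemma adm_mono_eqmor (X Y : C) (e : X = Y) : adm_mono (eqmor e).
Proof. by case: _ / e; exact: adm_mono_idm. Qed.

End ExactFacts.

(** * Arithmetic structures *)

(* [pull hf] is f^* and [push hg] is g_*, for [hf] (resp. [hg]) a proof that f
   is an admissible monomorphism (resp. g an admissible epimorphism). *)
Record arith_structure (C : exact_category) := ArithStructure {
  astr :> C -> Type;
  pull : forall (X Y : C) (f : mor X Y), adm_mono f -> astr Y -> astr X;
  push : forall (X Y : C) (g : mor X Y), adm_epi g -> astr X -> astr Y;
  astr_zobj : exists a : astr zobj, forall b : astr zobj, b = a;
  pull_comp : forall (X Y Z : C) (i : mor X Y) (j : mor Y Z)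
    (hi : adm_mono i) (hj : adm_mono j) (hji : adm_mono (j \oc i)) (h : astr Z),
    pull hji h = pull hi (pull hj h);
  push_comp : forall (X Y Z : C) (p : mor X Y) (q : mor Y Z)
    (hp : adm_epi p) (hq : adm_epi q) (hqp : adm_epi (q \oc p)) (h : astr X),
    push hqp h = push hq (push hp h);
  pull_idm : forall (X : C) (h1 : adm_mono (idm X)) (h : astr X), pull h1 h = h;
  push_idm : forall (X : C) (h1 : adm_epi (idm X)) (h : astr X), push h1 h = h;
  pull_push_iso : forall (X Y : C) (f : mor X Y)
    (hm : adm_mono f) (he : adm_epi f), is_iso f ->
    forall h : astr X, pull hm (push he h) = h;
  push_pull_iso : forall (X Y : C) (f : mor X Y)
    (hm : adm_mono f) (he : adm_epi f), is_iso f ->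
    forall h : astr Y, push he (pull hm h) = h;
  pull_push_square : forall (X Y Z W : C)
    (u : mor X Y) (p : mor X Z) (q : mor Y W) (v : mor Z W)
    (hu : adm_mono u) (hv : adm_mono v) (hp : adm_epi p) (hq : adm_epi q),
    cartesian u p q v \/ cocartesian u p q v ->
    forall h : astr Y, pull hv (push hq h) = push hp (pull hu h);
  (* (id, vu) and pr2 are automatically admissible, by [ses_split] and
     [ses_iso]. *)
  glue : forall (X Y Z : C) (u : mor X Y) (v : mor Y Z)
    (hu : adm_epi u) (hv : adm_mono v)
    (hg : adm_mono (pairm (idm X) (v \oc u))) (hp : adm_epi (pr2 X Z))
    (hX : astr X) (hZ : astr Z),
    push hu hX = pull hv hZ ->
    exists h : astr (dsum X Z), pull hg h = hX /\ push hp h = hZ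
}.

(** * Grothendieck groups *)

(* The free abelian group on the classes of [T] modulo [iso], divided by the
   subgroup generated by [x] - [x'] - [x''] for (x', x, x'') in [exact3]. *)
Section Grothendieck.
Variables (T : Type) (iso : T -> T -> Prop) (exact3 : T -> T -> T -> Prop).

Definition iso_class : Type :=
  {c : set T | `[< exists x, c = [set y | iso x y]%classic >]}.

Definition iso_class_of (x : T) : iso_class :=
  exist _ [set y | iso x y]%classic (asboolT (ex_intro _ x erefl)).

Definition K0_rel (z : {freeg iso_class / int}) : Prop :=
  exists x' x x'', exact3 x' x x'' /\
    z = << iso_class_of x >> - << iso_class_of x' >> - << iso_class_of x'' >>.

Definition K0_sub : {pred {freeg iso_class / int}} :=
  [pred z | `[< forall S : zmodClosed {freeg iso_class / int},
                  (forall r, K0_rel r -> r \in S) -> z \in S >]].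

Lemma K0_sub_zmod_closed : zmod_closed K0_sub.
Proof.
have K0_subP z : (z \in K0_sub) <-> forall S : zmodClosed {freeg iso_class / int},
    (forall r, K0_rel r -> r \in S) -> z \in S.
  by rewrite unfold_in; split => /asboolP.
split=> [|a b]; first by apply/K0_subP => S _; exact: rpred0.
move=> /K0_subP Sa /K0_subP Sb; apply/K0_subP => S relS.
by apply: rpredB; [exact: Sa | exact: Sb].
Qed.

HB.instance Definition _ := GRing.isZmodClosed.Build _ K0_sub K0_sub_zmod_closed.

Definition K0_group : zmodType := Quotient.quot K0_sub.

Definition K0_class (x : T) : K0_group :=
  (\pi_(Quotient.quot K0_sub) << iso_class_of x >>)%qT.

End Grothendieck.

Definition ses_obj (C : exact_category) (X' X X'' : C) : Prop :=
  exists (i : mor X' X) (p : mor X X''), ses i p.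

Definition K0 (C : exact_category) : zmodType :=
  K0_group (@isomorphic C) (@ses_obj C).

Definition K0_of (C : exact_category) (X : C) : K0 C :=
  K0_class (@isomorphic C) (@ses_obj C) X.

(** * Arithmetic objects, degree, rank, slope *)

Record arith_object (C : exact_category) (A : arith_structure C) := ArithObject {
  aobj :> C;
  ah : A aobj
}.

Arguments ArithObject {C A}.

Section ArithObjects.
Variables (C : exact_category) (A : arith_structure C).
Implicit Types X Y Z : arith_object A.

Definition compatible X Y (f : mor X Y) : Prop :=
  exists Z (u : mor X Z) (v : mor Z Y) (hu : adm_mono u) (hv : adm_epi v),
    [/\ f = v \oc u, ah X = pull hu (ah Z) & ah Y = push hv (ah Z)].

(* Isomorphism in the category C_A of arithmetic objects and compatible
   morphisms. *)
Definition arith_isomorphic X Y : Prop :=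
  exists (f : mor X Y) (g : mor Y X),
    [/\ compatible f, compatible g, g \oc f = idm (aobj X)
      & f \oc g = idm (aobj Y)].

Definition arith_ses X' X X'' : Prop :=
  exists (i : mor X' X) (p : mor X X'') (hi : adm_mono i) (hp : adm_epi p),
    [/\ ses i p, ah X' = pull hi (ah X) & ah X'' = push hp (ah X)].

Definition arith_K0 : zmodType := K0_group arith_isomorphic arith_ses.

Definition arith_K0_of X : arith_K0 := K0_class arith_isomorphic arith_ses X.

Definition subobject X (Y : C) (i : mor Y X) (hi : adm_mono i) :
  arith_object A := ArithObject Y (pull hi (ah X)).

Definition quotient_object X (Z : C) (p : mor X Z) (hp : adm_epi p) :
  arith_object A := ArithObject Z (push hp (ah X)).

End ArithObjects.

Arguments subobject {C A} X {Y i} hi.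
Arguments quotient_object {C A} X {Z p} hp.

Record rank_function (C : exact_category) := RankFunction {
  rank_hom :> {additive K0 C -> int};
  rank_gt0 : forall X : C, nonzero X -> 0 < rank_hom (K0_of X)
}.

Section Slopes.
Variables (R : realType) (C : exact_category) (A : arith_structure C).
Variables (dg : {additive arith_K0 A -> R}) (rk : rank_function C).
Implicit Types X Y : arith_object A.

Definition slope X : R := dg (arith_K0_of X) / (rk (K0_of (aobj X)))%:~R.

Definition semistable X : Prop :=
  nonzero X /\
  forall (Y : C) (i : mor Y X) (hi : adm_mono i),
    nonzero Y -> slope (subobject X hi) <= slope X.

Definition subobject_slopes X : set R :=
  [set r | exists (Y : C) (i : mor Y X) (hi : adm_mono i),
             nonzero Y /\ r = slope (subobject X hi)]%classic.

(* [has_sup] is required since [sup] has a junk value on unbounded sets. *)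
Definition HN1 : Prop :=
  forall X, nonzero X ->
  exists (D : C) (i : mor D X) (hi : adm_mono i),
    [/\ nonzero D,
        has_sup (subobject_slopes X),
        slope (subobject X hi) = sup (subobject_slopes X)
      & forall (Y : C) (j : mor Y X) (hj : adm_mono j),
          nonzero Y -> slope (subobject X hj) = slope (subobject X hi) ->
          exists (f : mor Y D) (hf : adm_mono f),
            i \oc f = j /\ pull hf (pull hi (ah X)) = pull hj (ah X)].

Definition HN2 : Prop :=
  forall X Y, semistable X -> semistable Y -> slope Y < slope X ->
  forall f : mor X Y, compatible f -> f = 0.

Definition Harder_Narasimhan_category : Prop := HN1 /\ HN2.

End Slopes.

(** * Filtrations *)

(* A sequence 0 = X_0 -> X_1 -> ... -> X_n = X of admissible monomorphisms.  The
   entries of [fobj], [fmap] and [fincl] beyond the length n are irrelevant.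
   For i <= n, [fincl i] is the composite X_i -> X_{i+1} -> ... -> X_n = X. *)
Record filtration (C : exact_category) (X : C) := Filtration {
  flen : nat;
  fobj : nat -> C;
  fmap : forall i, mor (fobj i) (fobj i.+1);
  fmap_adm : forall i, (i < flen)%N -> adm_mono (fmap i);
  fobj_first : fobj 0 = zobj;
  fobj_last : fobj flen = X;
  fincl : forall i, mor (fobj i) X;
  fincl_last : fincl flen = eqmor fobj_last;
  fincl_step : forall i, (i < flen)%N -> fincl i = fincl i.+1 \oc fmap i
}.

Lemma fincl_adm (C : exact_category) (X : C) (F : filtration X) (i : nat) :
  (i <= flen F)%N -> adm_mono (fincl F i).
Proof.
move=> /subnKC; move: (flen F - i)%N => k; elim: k i => [|k IHk] i.
  by rewrite addn0 => ->; rewrite fincl_last; exact: adm_mono_eqmor.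
rewrite addnS => ik; have lti : (i < flen F)%N by rewrite -ik ltnS leq_addr.
rewrite fincl_step //; apply: adm_mono_comp; first exact: fmap_adm.
by apply: IHk; rewrite addSn.
Qed.

Section Filtrations.
Variables (C : exact_category) (A : arith_structure C).

(* (X_i, h_i), with h_i induced from h along X_i -> X. *)
Definition fsub (X : arith_object A) (F : filtration (aobj X)) (i : nat)
    (le_i : (i <= flen F)%N) : arith_object A :=
  subobject X (fincl_adm le_i).

(* [Q] is the cokernel X_{j+1} / X_j, for some choice of it, with the quotient
   structure of h_{j+1}. *)
Definition is_subquotient (X : arith_object A) (F : filtration (aobj X))
    (j : nat) (lt_j : (j < flen F)%N) (Q : arith_object A) : Prop :=
  exists (Z : C) (p : mor (fobj F j.+1) Z) (hp : adm_epi p),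
    ses (fmap F j) p /\ Q = quotient_object (fsub lt_j) hp.

(* Isomorphisms of sequences ending at the same X: the last component is the
   identity of X. *)
Definition filtration_iso (X : C) (F G : filtration X)
    (phi : forall i, mor (fobj F i) (fobj G i)) : Prop :=
  [/\ forall i, (i <= flen F)%N -> is_iso (phi i),
      forall i, (i < flen F)%N ->
        phi i.+1 \oc fmap F i = fmap G i \oc phi i
    & fincl G (flen F) \oc phi (flen F) = fincl F (flen F)].

(* Uniqueness of the isomorphism concerns the components 0 <= i <= n only. *)
Definition uniquely_isomorphic (X : C) (F G : filtration X) : Prop :=
  flen F = flen G /\
  exists phi : forall i, mor (fobj F i) (fobj G i),
    filtration_iso phi /\
    forall psi, filtration_iso psi ->
      forall i, (i <= flen F)%N -> psi i = phi i.

End Filtrations.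

Section HNFiltration.
Variables (R : realType) (C : exact_category) (A : arith_structure C).
Variables (dg : {additive arith_K0 A -> R}) (rk : rank_function C).

Definition HN_filtration (X : arith_object A) (F : filtration (aobj X)) : Prop :=
  (forall j (lt_j : (j < flen F)%N) Q,
     is_subquotient lt_j Q -> semistable dg rk Q) /\
  (forall j (lt_j : (j < flen F)%N) (lt_j1 : (j.+1 < flen F)%N) Q Q',
     is_subquotient lt_j Q -> is_subquotient lt_j1 Q' ->
     slope dg rk Q' < slope dg rk Q).

End HNFiltration.

(* Main.v *)
(* Existence: let D be the destabilizing subobject of X provided by (HN1).  The
   preimages in X of the destabilizing subobjects of the successive quotients
   X/X_i form the sequence; it is finite because the ranks of the X/X_i decrease,
   and if the slopes failed to decrease at step i+1, then X_{i+2}/X_i would be a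
   subobject of X/X_i of maximal slope not contained in X_{i+1}/X_i.

   Uniqueness: conversely, in any such sequence X_{i+1} is the preimage of the
   destabilizing subobject D of X/X_i.  Indeed the slope of D is at least that of
   X_{i+1}/X_i, hence greater than those of the later subquotients, so by (HN2) D
   lies in X_{i+1}/X_i; again by (HN2) the two slopes agree, and (HN1) gives the
   opposite inclusion. *)
Require Import Defs.
From mathcomp Require Import all_boot all_order all_algebra.
From mathcomp Require Import boolp classical_sets reals lra zify.

Set Implicit Arguments.
Unset Strict Implicit.
Unset Printing Implicit Defensive.

Import Order.TTheory GRing.Theory Num.Theory.
Local Open Scope ring_scope.

(** * Exact categories *)

Section Additive.
Variable C : additive_category.

Lemma mcomp0m (X Y Z : C) (f : mor X Y) : (0 : mor Y Z) \oc f = 0.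
Proof. by apply: (addIr (0 \oc f)); rewrite -mcompDl !add0r. Qed.

Lemma mcompm0 (X Y Z : C) (g : mor Y Z) : g \oc (0 : mor X Y) = 0.
Proof. by apply: (addIr (g \oc 0)); rewrite -mcompDr !add0r. Qed.

Lemma nonzeroE (X : C) : nonzero X <-> idm X <> 0.
Proof.
split=> [nX idX0|idX [f [g [gf _]]]].
  apply: nX; exists 0, 0; split; first by rewrite mcompm0 idX0.
  by rewrite mcomp0m [RHS]mor_to_zobj.
by apply: idX; rewrite -gf (mor_to_zobj f) mcompm0.
Qed.

Lemma is_iso_comp (X Y Z : C) (f : mor X Y) (g : mor Y Z) :
  is_iso f -> is_iso g -> is_iso (g \oc f).
Proof.
case=> f' [f'f ff'] [g' [g'g gg']]; exists (f' \oc g'); split.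
  by rewrite mcompA -(mcompA g) g'g mcompm1.
by rewrite mcompA -(mcompA f') ff' mcompm1.
Qed.

Lemma is_iso_eqmor (X Y : C) (e : X = Y) : is_iso (eqmor e).
Proof. by case: _ / e; exists (idm X); rewrite mcomp1m. Qed.

Lemma kernel_inj (K X Y T : C) (i : mor K X) (p : mor X Y) (s t : mor T K) :
  is_kernel i p -> i \oc s = i \oc t -> s = t.
Proof.
case=> pi0 uni est; have := uni _ (i \oc s).
by rewrite mcompA pi0 mcomp0m => /(_ erefl) [x [_ ux]]; rewrite -(ux s) ?(ux t).
Qed.

Lemma cokernel_inj (X Y Q T : C) (p : mor Y Q) (i : mor X Y) (s t : mor Q T) :
  is_cokernel p i -> s \oc p = t \oc p -> s = t.
Proof.
case=> pi0 uni est; have := uni _ (s \oc p).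
by rewrite -mcompA pi0 mcompm0 => /(_ erefl) [x [_ ux]]; rewrite -(ux s) ?(ux t).
Qed.

Lemma kernel_iso (K K' X Y : C) (i : mor K X) (i' : mor K' X) (p : mor X Y) :
  is_kernel i p -> is_kernel i' p ->
  exists f : mor K K', is_iso f /\ i' \oc f = i.
Proof.
move=> ki ki'; have [pi0 ui] := ki; have [pi'0 ui'] := ki'.
have [f [i'f _]] := ui' _ _ pi0; have [g [ig _]] := ui _ _ pi'0.
exists f; split=> //; exists g; split.
  by apply: (kernel_inj ki); rewrite mcompA ig i'f mcompm1.
by apply: (kernel_inj ki'); rewrite mcompA i'f ig mcompm1.
Qed.

Lemma cokernel_iso (X Y Q Q' : C) (i : mor X Y) (p : mor Y Q) (p' : mor Y Q') :
  is_cokernel p i -> is_cokernel p' i ->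
  exists f : mor Q Q', is_iso f /\ f \oc p = p'.
Proof.
move=> kp kp'; have [pi0 up] := kp; have [p'i0 up'] := kp'.
have [f [fp _]] := up _ _ p'i0; have [g [gp' _]] := up' _ _ pi0.
exists f; split=> //; exists g; split.
  by apply: (cokernel_inj kp); rewrite -mcompA fp gp' mcomp1m.
by apply: (cokernel_inj kp'); rewrite -mcompA gp' fp mcomp1m.
Qed.

End Additive.

Section Exact.
Variable C : exact_category.

Lemma ses_comp0 (X Y Z : C) (i : mor X Y) (p : mor Y Z) : ses i p -> p \oc i = 0.
Proof. by case/ses_kernel. Qed.

Lemma ses_mono (X Y Z T : C) (i : mor X Y) (p : mor Y Z) (s t : mor T X) :
  ses i p -> i \oc s = i \oc t -> s = t.
Proof. by move/ses_kernel => ki; apply: kernel_inj ki. Qed.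

Lemma ses_epi (X Y Z T : C) (i : mor X Y) (p : mor Y Z) (s t : mor Z T) :
  ses i p -> s \oc p = t \oc p -> s = t.
Proof. by move/ses_cokernel => kp; apply: cokernel_inj kp. Qed.

Lemma ses_lift (X Y Z T : C) (i : mor X Y) (p : mor Y Z) (a : mor T Y) :
  ses i p -> p \oc a = 0 -> exists t, i \oc t = a.
Proof. by move/ses_kernel => [_ u] /u [t [? _]]; exists t. Qed.

Lemma ses_desc (X Y Z T : C) (i : mor X Y) (p : mor Y Z) (a : mor Y T) :
  ses i p -> a \oc i = 0 -> exists t, t \oc p = a.
Proof. by move/ses_cokernel => [_ u] /u [t [? _]]; exists t. Qed.

Lemma adm_mono_inj (X Y T : C) (i : mor X Y) (s t : mor T X) :
  adm_mono i -> i \oc s = i \oc t -> s = t.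
Proof. by case=> Z [p]; apply: ses_mono. Qed.

Lemma ses_adm_mono (X Y Z : C) (i : mor X Y) (p : mor Y Z) :
  ses i p -> adm_mono i.
Proof. by exists Z, p. Qed.

Lemma ses_adm_epi (X Y Z : C) (i : mor X Y) (p : mor Y Z) :
  ses i p -> adm_epi p.
Proof. by exists X, i. Qed.

Lemma ses_of_kernel (X X' Y Z : C) (i : mor X Y) (i' : mor X' Y) (p : mor Y Z) :
  ses i p -> is_kernel i' p -> ses i' p.
Proof.
move=> s k; have [f [isof fi]] := kernel_iso (ses_kernel s) k.
apply: (ses_iso isof (is_iso_idm Y) (is_iso_idm Z) _ _ s).
  by rewrite mcomp1m.
by rewrite mcomp1m mcompm1.
Qed.

Lemma ses_of_cokernel (X Y Z Z' : C) (i : mor X Y) (p : mor Y Z) (p' : mor Y Z') :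
  ses i p -> is_cokernel p' i -> ses i p'.
Proof.
move=> s k; have [f [isof fp]] := cokernel_iso (ses_cokernel s) k.
apply: (ses_iso (is_iso_idm X) (is_iso_idm Y) isof _ _ s).
  by rewrite mcomp1m mcompm1.
by rewrite mcompm1.
Qed.

Lemma ses_idm0 (X : C) : ses (idm X) (0 : mor X zobj).
Proof.
have b_iso : is_iso (pr1 X zobj).
  exists (inl_ X zobj); rewrite pr1_inl; split=> //.
  by rewrite -(dsum_idm X zobj) (mor_from_zobj (inr_ X zobj)) mcomp0m addr0.
apply: (ses_iso (is_iso_idm X) b_iso (is_iso_idm zobj) _ _ (ses_split X zobj)).
  by rewrite mcompm1 pr1_inl.
by rewrite [LHS]mor_to_zobj [RHS]mor_to_zobj.
Qed.

Lemma ses_0idm (X : C) : ses (0 : mor zobj X) (idm X).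
Proof.
have b_iso : is_iso (pr2 zobj X).
  exists (inr_ zobj X); rewrite pr2_inr; split=> //.
  by rewrite -(dsum_idm zobj X) (mor_from_zobj (inl_ zobj X)) mcomp0m add0r.
apply: (ses_iso (is_iso_idm zobj) b_iso (is_iso_idm X) _ _ (ses_split zobj X)).
  by rewrite [LHS]mor_from_zobj [RHS]mor_from_zobj.
by rewrite !mcomp1m.
Qed.

Lemma ses_iso0 (X Y : C) (f : mor X Y) : is_iso f -> ses f (0 : mor Y zobj).
Proof.
move=> isof.
apply: (ses_iso (is_iso_idm X) isof (is_iso_idm zobj) _ _ (ses_idm0 X)).
  by rewrite !mcompm1.
by rewrite [LHS]mor_to_zobj [RHS]mor_to_zobj.
Qed.

Lemma adm_mono_iso (X Y : C) (f : mor X Y) : is_iso f -> adm_mono f.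
Proof. by move/ses_iso0/ses_adm_mono. Qed.

Lemma adm_epi_idm (X : C) : adm_epi (idm X).
Proof. exact: ses_adm_epi (ses_0idm X). Qed.

Lemma adm_epi_comp (X Y Z : C) (p : mor X Y) (q : mor Y Z) :
  adm_epi p -> adm_epi q -> adm_epi (q \oc p).
Proof. exact: adm_epi_comp_ax. Qed.

Lemma adm_mono_split_iso (X Y : C) (i : mor X Y) (s : mor Y X) :
  adm_mono i -> i \oc s = idm Y -> is_iso i.
Proof.
move=> ai si; exists s; split=> //.
by apply: (adm_mono_inj ai); rewrite mcompA si mcomp1m mcompm1.
Qed.

Lemma ses_zero_iso (X Y Z : C) (i : mor X Y) (p : mor Y Z) :
  ses i p -> ~ nonzero Z -> is_iso i.
Proof.
move=> s nZ; have idZ : idm Z = 0 by apply: contrapT => /nonzeroE.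
have [|t it] := ses_lift (a := idm Y) s.
  by rewrite mcompm1 -[p]mcomp1m idZ mcomp0m.
exact: adm_mono_split_iso (ses_adm_mono s) it.
Qed.

Lemma ses_iso_zero (X Y Z : C) (i : mor X Y) (p : mor Y Z) (s : mor Y X) :
  ses i p -> i \oc s = idm Y -> ~ nonzero Z.
Proof.
move=> ip is1 /nonzeroE; apply; apply: (ses_epi ip).
by rewrite mcomp1m mcomp0m -[p]mcompm1 -is1 mcompA (ses_comp0 ip) mcomp0m.
Qed.

Lemma adm_mono_nonzero (X Y : C) (i : mor X Y) :
  adm_mono i -> nonzero X -> nonzero Y.
Proof.
move=> ai /nonzeroE nX; apply/nonzeroE => idY; apply: nX.
by apply: (adm_mono_inj ai); rewrite mcompm1 mcompm0 -[i]mcomp1m idY mcomp0m.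
Qed.

(* The map Z/Y -> X/Y is admissible
   because X/Y is the pushout of X along Z -> Z/Y. *)
Lemma noether (Y Z X QZ QX G : C) (a : mor Y Z) (b : mor Z X)
    (pZ : mor Z QZ) (pX : mor X QX) (r : mor X G) :
  ses a pZ -> ses b r -> ses (b \oc a) pX ->
  exists (e : mor QZ QX) (r' : mor QX G),
    [/\ e \oc pZ = pX \oc b, r' \oc pX = r, ses e r' & cocartesian b pZ pX e].
Proof.
move=> sZ sr sX.
have [|e epZ] := ses_desc (a := pX \oc b) sZ.
  by rewrite -mcompA (ses_comp0 sX).
have [|r' r'pX] := ses_desc (a := r) sX.
  by rewrite mcompA (ses_comp0 sr) mcomp0m.
have cc : cocartesian b pZ pX e.
  split=> // T x y xb.
  have [|t tpX] := ses_desc (a := x) sX.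
    by rewrite mcompA xb -mcompA (ses_comp0 sZ) mcompm0.
  exists t; split.
    by split=> //; apply: (ses_epi sZ); rewrite -mcompA epZ mcompA tpX.
  by move=> t' [t'pX _]; apply: (ses_epi sX); rewrite tpX.
(* The square just found and the pushout [W] of the axiom solve the same universal problem, so the
   comparison [t] is invertible and [e] inherits admissibility from [v]. *)
have [W [q [v [[qb uW] av]]]] := adm_mono_pushout_ax pZ (ses_adm_mono sr).
have [|s spX] := ses_desc (a := q) sX.
  by rewrite mcompA qb -mcompA (ses_comp0 sZ) mcompm0.
have [t [[tq tv] _]] := uW _ pX e (esym epZ).
have isot : is_iso t.
  exists s; split; last first.
    by apply: (ses_epi sX); rewrite -mcompA spX tq mcomp1m.
  have [x [_ ux]] := uW _ q v qb.
  have xid : x = idm W by apply: ux; rewrite !mcomp1m.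
  rewrite -[RHS]xid; apply/esym/ux; rewrite -!mcompA tq tv; split=> //.
  by apply: (ses_epi sZ); rewrite -mcompA epZ mcompA spX.
have [K [c0 sc0]] : adm_mono e.
  by rewrite -tv; apply: adm_mono_comp av (adm_mono_iso isot).
exists e, r'; split=> //; apply: (ses_of_cokernel sc0); split.
  by apply: (ses_epi sZ); rewrite -mcompA epZ mcompA r'pX (ses_comp0 sr) mcomp0m.
move=> T x xe.
have [|y yr] := ses_desc (a := x \oc pX) sr.
  by rewrite -mcompA -epZ mcompA xe mcomp0m.
exists y; split; first by apply: (ses_epi sX); rewrite -mcompA r'pX.
by move=> y' y'r'; apply: (ses_epi sr); rewrite yr -y'r' -mcompA r'pX.
Qed.

(** If [c] is a cokernel of [v], then [u] is a kernel of the admissible epimorphism [c \oc q]. *)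
Lemma adm_mono_cartesian (X Y Z W : C)
    (u : mor X Y) (p : mor X Z) (q : mor Y W) (v : mor Z W) :
  cartesian u p q v -> adm_epi q -> adm_mono v -> adm_mono u.
Proof.
move=> [qu uX] aq av; have [Q [c sc]] := av.
have [K [k sk]] := adm_epi_comp aq (ses_adm_epi sc).
apply: (@ses_adm_mono _ _ Q _ (c \oc q)); apply: (ses_of_kernel sk); split.
  by rewrite -mcompA qu mcompA (ses_comp0 sc) mcomp0m.
move=> T a; rewrite -mcompA => /(ses_lift sc) [b vb].
have [t [[ut pt] unit]] := uX _ a b (esym vb).
exists t; split=> // t' ut'; apply: unit; split=> //.
by apply: (adm_mono_inj av); rewrite vb mcompA -qu -mcompA ut'.
Qed.

(** [P] is the pullback of [d] along [p], that is, the preimage in X of the subobject D of X/Y; Y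
    enters it through the pair ([i], 0), which is a kernel of [pD]. *)
Lemma ses_preimage (Y X Q D : C) (i : mor Y X) (p : mor X Q) (d : mor D Q) :
  ses i p -> adm_mono d ->
  exists (P : C) (u : mor P X) (w : mor Y P) (pD : mor P D),
    [/\ adm_mono u, u \oc w = i, ses w pD & p \oc u = d \oc pD].
Proof.
move=> sp ad.
have [P [u [pD [cart apD]]]] := adm_epi_pullback_ax d (ses_adm_epi sp).
have au := adm_mono_cartesian cart (ses_adm_epi sp) ad.
have [pu uP] := cart.
have [|w [[uw pDw] _]] := uP _ i (0 : mor Y D).
  by rewrite (ses_comp0 sp) mcompm0.
exists P, u, w, pD; split=> //; have [K [k sk]] := apD.
apply: (ses_of_kernel sk); split=> // T a pDa.
have [|t it] := ses_lift (a := u \oc a) sp.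
  by rewrite mcompA pu -mcompA pDa mcompm0.
exists t; split; first by apply: (adm_mono_inj au); rewrite mcompA uw.
by move=> t' wt'; apply: (ses_mono sp); rewrite it -wt' mcompA uw.
Qed.

(** The graph is the split inclusion of X followed by the shear automorphism [idm _ + n k], whose
    inverse is [idm _ + n (- k)] because [n] is additive and its values have product zero. *)
Lemma adm_mono_graph (X Y : C) (k : mor X Y) : adm_mono (pairm (idm X) k).
Proof.
pose n k' := inr_ X Y \oc k' \oc pr1 X Y.
have nD k1 k2 : n (k1 + k2) = n k1 + n k2 by rewrite /n mcompDr mcompDl.
have nn k1 k2 : n k1 \oc n k2 = 0.
  rewrite /n -!mcompA (mcompA _ (inr_ X Y) (pr1 X Y)).
  by rewrite pr1_inr !mcomp0m !mcompm0.
have bb k1 k2 : k1 + k2 = 0 ->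
    (idm _ + n k1) \oc (idm _ + n k2) = idm (dsum X Y).
  move=> k12; rewrite mcompDl !mcompDr !mcomp1m mcompm1 nn addr0 -addrA.
  by rewrite -nD (addrC k2) k12 /n mcompm0 mcomp0m addr0.
have isob : is_iso (idm _ + n k).
  by exists (idm _ + n (- k)); rewrite !bb ?subrr ?addNr.
apply: (@ses_adm_mono _ _ _ _ (pr2 X Y \oc (idm _ + n (- k)))).
apply: (ses_iso (is_iso_idm X) isob (is_iso_idm Y) _ _ (ses_split X Y)).
  rewrite mcompm1 /pairm mcompm1 mcompDl mcomp1m /n.
  by rewrite -mcompA pr1_inl mcompm1.
by rewrite -mcompA bb ?addNr // mcompm1 mcomp1m.
Qed.

End Exact.

(** * Arithmetic structures, slopes and destabilizing subobjects *)

Section Arithmetic.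
Variables (C : exact_category) (A : arith_structure C).

(** Admissibility proofs depend on the morphism, so the composite is given up to an equation. *)
Lemma pull_compE (X Y Z : C) (i : mor X Y) (j : mor Y Z) (f : mor X Z)
    (hi : adm_mono i) (hj : adm_mono j) (hf : adm_mono f) (h : A Z) :
  j \oc i = f -> pull hf h = pull hi (pull hj h).
Proof. by move=> e; case: _ / e hf => hf; apply: pull_comp. Qed.

Lemma push_compE (X Y Z : C) (p : mor X Y) (q : mor Y Z) (f : mor X Z)
    (hp : adm_epi p) (hq : adm_epi q) (hf : adm_epi f) (h : A X) :
  q \oc p = f -> push hf h = push hq (push hp h).
Proof. by move=> e; case: _ / e hf => hf; apply: push_comp. Qed.

(* The structure witnessing compatibility lives on Y (+) X': it is induced from
   the one (A7) provides on Y (+) X.  Admissibility of [k] is not available,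
   since [C] need not be weakly idempotent complete. *)
Lemma compatible_through (Y X X' Z : C) (i : mor Y X) (m : mor X' X)
    (k : mor Y X') (p : mor X' Z) (hi : adm_mono i) (hm : adm_mono m)
    (hp : adm_epi p) (h : A X) :
  m \oc k = i ->
  @compatible C A (ArithObject Y (pull hi h))
    (ArithObject Z (push hp (pull hm h))) (p \oc k).
Proof.
move=> mk.
have hg := adm_mono_graph (i \oc idm Y).
have he X0 : adm_epi (pr2 Y X0) := ses_adm_epi (ses_split Y X0).
(* (A7) for the factorization of [i] as the identity of Y followed by [i]. *)
have [h1 [h1Y h1X]] := glue hg (he X) (push_idm (adm_epi_idm Y) (pull hi h)).
(* [M] is the direct sum of the identity of Y and [m]. It is the base change of [m] along [pr2], so
   (A6) describes the structure that [h1] induces through it. *)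
pose M := inl_ Y X \oc pr1 Y X' + inr_ Y X \oc m \oc pr2 Y X'.
have pr1M : pr1 Y X \oc M = pr1 Y X'.
  by rewrite mcompDr !mcompA pr1_inl pr1_inr !mcomp0m mcomp1m addr0.
have pr2M : pr2 Y X \oc M = m \oc pr2 Y X'.
  by rewrite mcompDr !mcompA pr2_inl pr2_inr !mcomp0m mcomp1m add0r.
have cart : cartesian M (pr2 Y X') (pr2 Y X) m.
  split=> // T a b ab.
  exists (pairm (pr1 Y X \oc a) b); split.
    split.
      rewrite /M /pairm mcompDl !mcompDr -!mcompA.
      rewrite !(mcompA _ _ (pr1 Y X')) !(mcompA _ _ (pr2 Y X')).
      rewrite pr1_inl pr1_inr pr2_inl pr2_inr !mcomp0m !mcompm0 addr0 add0r.
      by rewrite !mcomp1m -ab !mcompA -mcompDl dsum_idm mcomp1m.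
    by rewrite /pairm mcompDr !mcompA pr2_inl pr2_inr !mcomp0m mcomp1m add0r.
  move=> t [Mt <-]; rewrite -Mt (mcompA t M) pr1M /pairm !mcompA -mcompDl.
  by rewrite dsum_idm mcomp1m.
have hM := adm_mono_cartesian cart (he X) hm.
have sq := pull_push_square hM hm (he X') (he X) (or_introl cart) h1.
have hgk := adm_mono_graph k.
exists (ArithObject (dsum Y X') (pull hM h1)), (pairm (idm Y) k).
exists (p \oc pr2 Y X'), hgk, (adm_epi_comp (he X') hp); split=> /=.
- by rewrite /pairm -mcompA mcompDr !mcompA pr2_inl pr2_inr !mcomp0m mcomp1m add0r.
- rewrite -(pull_compE hgk hM hg) ?h1Y // /pairm !mcompm1 -mk /M.
  rewrite mcompDl !mcompDr -!mcompA.
  rewrite !(mcompA _ _ (pr1 Y X')) !(mcompA _ _ (pr2 Y X')).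
  rewrite pr1_inl pr1_inr pr2_inl pr2_inr !mcomp0m !mcompm0 addr0 add0r.
  by rewrite mcompm1 mcomp1m.
- by rewrite (push_compE (he X') hp) // -sq h1X.
Qed.

End Arithmetic.

(** * Grothendieck groups and slopes *)

Section GrothendieckExact.
Variables (T : Type) (iso : T -> T -> Prop) (exact3 : T -> T -> T -> Prop).

Lemma K0_class_exact (x' x x'' : T) : exact3 x' x x'' ->
  K0_class iso exact3 x = K0_class iso exact3 x' + K0_class iso exact3 x''.
Proof.
move=> ex; rewrite /K0_class -raddfD /=.
apply/eqP; rewrite -Quotient.idealrBE opprD addrA unfold_in.
by apply/asboolP => S; apply; exists x', x, x''.
Qed.

End GrothendieckExact.

Section Slopes.
Variables (R : realType) (C : exact_category) (A : arith_structure C).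
Variables (dg : {additive arith_K0 A -> R}) (rk : rank_function C).
Implicit Types X Y Z : arith_object A.
Local Notation deg X := (dg (arith_K0_of X)).
Local Notation rank X := (rk (K0_of X)).

Lemma rank_exact (X' X X'' : C) (i : mor X' X) (p : mor X X'') :
  ses i p -> rank X = rank X' + rank X''.
Proof.
by move=> s; rewrite -raddfD; congr (rk _); apply: K0_class_exact; exists i, p.
Qed.

Lemma deg_exact X' X X'' (i : mor X' X) (p : mor X X'')
    (hi : adm_mono i) (hp : adm_epi p) :
  ses i p -> ah X' = pull hi (ah X) -> ah X'' = push hp (ah X) ->
  deg X = deg X' + deg X''.
Proof.
move=> s e' e''; rewrite -raddfD; congr (dg _); apply: K0_class_exact.
by exists i, p, hi, hp.
Qed.

(** By (A1) all structures on the zero object agree, so additivity along 0 -> 0 -> 0 shows that the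
    degree equals its double. *)
Lemma deg_zobj (a : A zobj) : deg (ArithObject zobj a) = 0.
Proof.
have [b ub] := astr_zobj A.
have := deg_exact (X' := ArithObject zobj a) (X := ArithObject zobj a)
  (X'' := ArithObject zobj a) (hi := adm_mono_idm _)
  (hp := ses_adm_epi (ses_idm0 zobj)) (ses_idm0 zobj).
rewrite /= (ub a) (ub (pull _ _)) (ub (push _ _)) => /(_ erefl erefl) /eqP.
by rewrite eq_sym -subr_eq0 addrK => /eqP.
Qed.

Lemma rank_iso (X Y : C) (f : mor X Y) : is_iso f -> rank X = rank Y.
Proof.
have r0 : rank (@zobj C) = 0.
  have /eqP := rank_exact (ses_idm0 (@zobj C)).
  by rewrite eq_sym -subr_eq0 addrK => /eqP.
by move=> /ses_iso0/rank_exact ->; rewrite r0 addr0.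
Qed.

(** An isomorphism is an admissible monomorphism with zero cokernel, and the zero object contributes
    neither degree nor rank. *)
Lemma slope_iso X Y (f : mor X Y) (hf : adm_mono f) :
  is_iso f -> ah X = pull hf (ah Y) -> slope dg rk X = slope dg rk Y.
Proof.
move=> isof e; rewrite /slope (rank_iso isof).
have s := ses_iso0 isof.
have -> // := @deg_exact X Y (ArithObject _ (push (ses_adm_epi s) (ah Y)))
  _ _ hf (ses_adm_epi s) s e erefl.
by rewrite deg_zobj addr0.
Qed.

Lemma rank_gt0R (X : C) : nonzero X -> 0 < (rank X)%:~R :> R.
Proof. by move=> nX; rewrite ltr0z; apply: rank_gt0. Qed.

(** The slope of the middle term is the mediant of the outer two, weighted by positive ranks, so it
    lies between them. *)
Lemma slope_le_mid X' X X'' (i : mor X' X) (p : mor X X'')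
    (hi : adm_mono i) (hp : adm_epi p) :
  ses i p -> ah X' = pull hi (ah X) -> ah X'' = push hp (ah X) ->
  nonzero X' -> nonzero X'' ->
  slope dg rk X' <= slope dg rk X'' -> slope dg rk X' <= slope dg rk X.
Proof.
move=> s e' e'' n' n''; have r' := rank_gt0R n'; have r'' := rank_gt0R n''.
rewrite /slope (rank_exact s) (deg_exact s e' e'') rmorphD /=.
rewrite !ler_pdivrMr ?addr_gt0 // ![_ / _ * _]mulrAC !ler_pdivlMr ?addr_gt0 //.
move=> H; nra.
Qed.

(** The subobject of (HN1), with a maximum in place of the supremum; it is a property of a given
    monomorphism, so that it can be moved along isomorphisms of subobjects. *)
Definition destabilizing X (D : C) (i : mor D X) (hi : adm_mono i) : Prop :=
  [/\ nonzero D,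
      forall (Y : C) (j : mor Y X) (hj : adm_mono j), nonzero Y ->
        slope dg rk (subobject X hj) <= slope dg rk (subobject X hi)
    & forall (Y : C) (j : mor Y X) (hj : adm_mono j), nonzero Y ->
        slope dg rk (subobject X hj) = slope dg rk (subobject X hi) ->
        exists f : mor Y D, i \oc f = j].

Lemma destabilizing_exists : HN1 dg rk -> forall X, nonzero X ->
  exists (D : C) (i : mor D X) (hi : adm_mono i), destabilizing hi.
Proof.
move=> H X /H [D [i [hi [nD hs eD uD]]]]; exists D, i, hi; split=> // Y j hj nY.
  by rewrite eD; apply: sup_ubound; [case: hs | exists Y, j, hj].
by move=> /(uD _ _ _ nY) [f [_ [fj _]]]; exists f.
Qed.

Lemma destabilizing_iso X (D D' : C) (i : mor D X) (i' : mor D' X)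
    (hi : adm_mono i) (hi' : adm_mono i') (f : mor D' D) :
  destabilizing hi -> is_iso f -> i \oc f = i' -> destabilizing hi'.
Proof.
move=> [nD lD uD] isof fi.
have es : slope dg rk (subobject X hi') = slope dg rk (subobject X hi).
  apply: (@slope_iso (subobject X hi') (subobject X hi) f (adm_mono_iso isof) isof).
  exact: pull_compE.
have [g [gf fg]] := isof.
have isog : is_iso g by exists f.
split=> [||Y j hj nY]; first exact: adm_mono_nonzero (adm_mono_iso isog) nD.
  by rewrite es.
rewrite es => /(uD _ _ _ nY) [k ik]; exists (g \oc k).
by rewrite mcompA -fi -(mcompA g) fg mcompm1.
Qed.

(** By (A2) a subobject of D with its induced structure is a subobject of X. *)
Lemma destabilizing_semistable X (D : C) (i : mor D X) (hi : adm_mono i) :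
  destabilizing hi -> semistable dg rk (subobject X hi).
Proof.
move=> [nD lD _]; split=> // Y j hj nY.
have -> : subobject (subobject X hi) hj = subobject X (adm_mono_comp hj hi).
  by rewrite /subobject /=; congr ArithObject; apply/esym/pull_compE.
exact: lD.
Qed.

End Slopes.

(** * Existence *)

Section Chains.
Variables (C : exact_category) (X : C).

(** An inductive form of filtrations that lets the construction prepend one term at a time. The
    functions below turn a chain into families indexed by [nat], continued by X and its identity
    beyond the length. *)
Inductive chain (Y : C) : Type :=
| chain_last of mor Y X
| chain_step Z of mor Y Z & chain Z.

Fixpoint clen Y (c : chain Y) : nat :=
  if c is chain_step _ _ c' then (clen c').+1 else 1.

Fixpoint cobj Y (c : chain Y) (k : nat) {struct k} : C :=
  if k is k'.+1 then
    match c with chain_last _ => X | chain_step _ _ c' => cobj c' k' end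
  else Y.

Fixpoint cmap Y (c : chain Y) : forall k, mor (cobj c k) (cobj c k.+1) :=
  match c return forall k, mor (cobj c k) (cobj c k.+1) with
  | chain_last f => fun k =>
      match k return mor (cobj (chain_last f) k) (cobj (chain_last f) k.+1) with
      | 0 => f
      | _.+1 => idm X
      end
  | chain_step _ f c' => fun k =>
      match k return mor (cobj (chain_step f c') k) (cobj (chain_step f c') k.+1)
      with
      | 0 => f
      | k'.+1 => cmap c' k'
      end
  end.

Fixpoint cincl Y (c : chain Y) : forall k, mor (cobj c k) X :=
  match c return forall k, mor (cobj c k) X with
  | chain_last f => fun k =>
      match k return mor (cobj (chain_last f) k) X with
      | 0 => f
      | _.+1 => idm X
      end
  | chain_step _ f c' => fun k =>
      match k return mor (cobj (chain_step f c') k) X with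
      | 0 => cincl c' 0 \oc f
      | k'.+1 => cincl c' k'
      end
  end.

Lemma cincl_last Y (c : chain Y) :
  exists e : cobj c (clen c) = X, cincl c (clen c) = eqmor e.
Proof. by elim: Y / c => [Y f|Y Z f c IH]; [exists erefl | exact: IH]. Qed.

Lemma cincl_step Y (c : chain Y) k : (k < clen c)%N ->
  cincl c k = cincl c k.+1 \oc cmap c k.
Proof.
elim: Y / c k => [Y f|Y Z f c IH] [|k] //=; first by rewrite mcomp1m.
exact: IH.
Qed.

End Chains.

(** * Construction of the filtration *)

Section Existence.
Variables (R : realType) (C : exact_category) (A : arith_structure C).
Variables (dg : {additive arith_K0 A -> R}) (rk : rank_function C).
Local Notation sl := (slope dg rk).
Local Notation rank X := (rk (K0_of X)).

(** Any cokernel of Y -> P is isomorphic to D over X/Y. By (A6) its structure as a quotient of P is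
    the one induced from X/Y, so the graded piece is itself the destabilizing subobject of X/Y. *)
Lemma graded_destabilizing (X : arith_object A) (Y Q D P Z : C) (i : mor Y X)
    (p : mor X Q) (d : mor D Q) (u : mor P X) (w : mor Y P) (pD : mor P D)
    (p' : mor P Z) (hp : adm_epi p) (hd : adm_mono d) (hu : adm_mono u)
    (hp' : adm_epi p') :
  ses i p -> u \oc w = i -> ses w pD -> p \oc u = d \oc pD ->
  @destabilizing _ _ _ dg rk (quotient_object X hp) D d hd -> ses w p' ->
  exists (e : mor Z Q) (he : adm_mono e),
    [/\ e \oc p' = p \oc u,
        @destabilizing _ _ _ dg rk (quotient_object X hp) Z e he
      & push hp' (pull hu (ah X)) = pull he (push hp (ah X))].
Proof.
move=> sp uw sD pu des s'; have [G [r sr]] := hu.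
have [|e [r' [ep' r'p se cc]]] := noether s' sr (pX := p); first by rewrite uw.
have he := ses_adm_mono se; exists e, he; split=> //.
  have [f [isof fp']] := cokernel_iso (ses_cokernel s') (ses_cokernel sD).
  apply: (destabilizing_iso _ des isof).
  by apply: (ses_epi s'); rewrite -mcompA fp' ep'.
by apply/esym/pull_push_square; right.
Qed.

(** Otherwise the mediant inequality for P/Y -> P2/Y -> P2/P gives P2/Y at least the slope of P/Y,
    hence the maximal slope. Then P2/Y is contained in P/Y, which forces P2/P to vanish. *)
Lemma graded_slope_lt (X : arith_object A) (Y Q P Z P2 G : C) (i : mor Y X)
    (p : mor X Q) (u : mor P X) (w : mor Y P) (p' : mor P Z) (e : mor Z Q)
    (b : mor P P2) (u2 : mor P2 X) (r : mor P2 G)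
    (hp : adm_epi p) (he : adm_mono e) (hu2 : adm_mono u2) (hr : adm_epi r) :
  ses i p -> ses w p' -> u \oc w = i -> e \oc p' = p \oc u ->
  u2 \oc b = u -> ses b r -> nonzero G ->
  @destabilizing _ _ _ dg rk (quotient_object X hp) Z e he ->
  sl (quotient_object (subobject X hu2) hr) <
  sl (subobject (quotient_object X hp) he).
Proof.
move=> sp s' uw ep' u2b sr nG [nZ leZ unZ].
have ab : adm_mono (b \oc w).
  exact: adm_mono_comp (ses_adm_mono s') (ses_adm_mono sr).
have [Z2 [q2 s2]] := ab.
have [eps [r' [epsp' r'q2 se _]]] := noether s' sr s2.
have [G2 [c2 sc2]] := hu2.
have [|e2 [c2' [e2q2 _ se2 cc]]] := noether s2 sc2 (pX := p).
  by rewrite mcompA u2b uw.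
have he2 := ses_adm_mono se2; have heps := ses_adm_mono se.
have e2eps : e2 \oc eps = e.
  by apply: (ses_epi s'); rewrite ep' -mcompA epsp' mcompA e2q2 -mcompA u2b.
have nZ2 := adm_mono_nonzero heps nZ.
rewrite ltNge; apply/negP => leG.
have leZ2 : sl (subobject (quotient_object X hp) he) <=
            sl (subobject (quotient_object X hp) he2).
  apply: (@slope_le_mid _ _ _ dg rk (subobject (quotient_object X hp) he)
    (subobject (quotient_object X hp) he2)
    (quotient_object (subobject X hu2) hr)
    eps r' heps (ses_adm_epi se) se) => //=.
  - exact: pull_compE.
  - rewrite (pull_push_square hu2 he2 (ses_adm_epi s2) hp (or_intror cc)).
    exact: push_compE.
have [|f ef] := unZ _ _ he2 nZ2; first by apply/le_anti; rewrite leZ2 leZ.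
apply: (ses_iso_zero se (s := f)) nG.
by apply: (adm_mono_inj he2); rewrite mcompA e2eps ef mcompm1.
Qed.

(** Induction on a bound [n] for the rank of X/Y. Cokernels and admissibility proofs are quantified
    over, since [is_subquotient] allows every choice of them. *)
Lemma chain_exists (X : arith_object A) : HN1 dg rk ->
  forall (n : nat) (Y Q : C) (i : mor Y X) (p : mor X Q),
  ses i p -> nonzero Q -> rank Q <= n%:Z ->
  exists c : chain (aobj X) Y,
  [/\ cincl c 0 = i,
      forall k, (k < clen c)%N -> adm_mono (cmap c k),
      forall k, (k <= clen c)%N -> adm_mono (cincl c k),
      forall k (hi : adm_mono (cincl c k.+1)) Z (q : mor _ Z) (hq : adm_epi q),
        (k < clen c)%N -> ses (cmap c k) q ->
        semistable dg rk (quotient_object (subobject X hi) hq)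
    & forall k (hi : adm_mono (cincl c k.+1)) (hi' : adm_mono (cincl c k.+2))
        Z (q : mor _ Z) (hq : adm_epi q) Z' (q' : mor _ Z') (hq' : adm_epi q'),
        (k.+1 < clen c)%N -> ses (cmap c k) q -> ses (cmap c k.+1) q' ->
        sl (quotient_object (subobject X hi') hq') <
        sl (quotient_object (subobject X hi) hq)].
Proof.
move=> H1; elim=> [|n IH] Y Q i p sp nQ.
  by move=> /(lt_le_trans (rank_gt0 rk nQ)); rewrite ltxx.
move=> rQ; have hp := ses_adm_epi sp.
have [D [d [hd des]]] := destabilizing_exists H1 (X := quotient_object X hp) nQ.
have [Q' [c sd]] := hd; have [nD _ _] := des.
(* If D is all of X/Y, then its preimage is X and the chain stops. *)
have [nQ'|zQ'] := pselect (nonzero Q'); last first.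
  have [g [gd dg1]] := ses_zero_iso sd zQ'.
  have sw : ses i (g \oc p).
    apply: (ses_iso (is_iso_idm _) (is_iso_idm _) (c := g) _ _ _ sp).
    - by exists d.
    - by rewrite mcompm1 mcomp1m.
    - by rewrite mcompm1.
  exists (chain_last i); split=> //=.
  - by case=> // _; exact: ses_adm_mono sp.
  - by case=> [|k] _; [exact: ses_adm_mono sp | exact: adm_mono_idm].
  - case=> // hi Z q hq _ sq.
    have [||e [he [_ des' E]]] := graded_destabilizing hi hq sp _ sw _ des sq.
    + by rewrite mcomp1m.
    + by rewrite mcompm1 mcompA dg1 mcomp1m.
    by rewrite /quotient_object /= E; exact: (destabilizing_semistable des').
have [P [u [w [pD [hu uw sw pu]]]]] := ses_preimage sp hd.
have [G [r sr]] := hu.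
have [|e' [r' [e'pD r'p se' _]]] := noether sw sr (pX := p); first by rewrite uw.
(* Hence X/P and the cokernel of D in X/Y are cokernels of the same map, and X/P is non-zero. *)
have e'd : e' = d by apply: (ses_epi sw); rewrite e'pD.
rewrite e'd in se'.
have nG : nonzero G.
  have [f [[g [gf fg]] _]] := cokernel_iso (ses_cokernel se') (ses_cokernel sd).
  apply: (adm_mono_nonzero (i := g) _ nQ').
  by apply: adm_mono_iso; exists f.
have [|c' [c'0 c'm c'i c'ss c'lt]] := IH P G u r sr nG.
  (* The rank of X/P drops by that of D, which is positive. *)
  move: rQ; rewrite (rank_exact rk se') => rQ.
  have := rank_gt0 rk nD; lia.
exists (chain_step w c'); split=> /=.
- by rewrite c'0.
- by case=> [_|k]; [exact: ses_adm_mono sw | exact: c'm].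
- case=> [_|k]; last exact: c'i.
  by rewrite c'0 uw; exact: ses_adm_mono sp.
- case=> [hi Z q hq _ sq|k]; last exact: c'ss.
  have [||e [he [_ des' E]]] := graded_destabilizing hi hq sp _ sw _ des sq.
  + by rewrite c'0.
  + by rewrite c'0.
  by rewrite /quotient_object /= E; exact: (destabilizing_semistable des').
(* Only the comparison of the first two graded pieces is new. *)
- case=> [hi hi' Z q hq Z' q' hq' lt0 sq sq'|k]; last exact: c'lt.
  have uw' : cincl c' 0 \oc w = i by rewrite c'0.
  have [|e [he [eq des' E]]] := graded_destabilizing hi hq sp uw' sw _ des sq.
    by rewrite c'0.
  rewrite [X in _ < sl X]/quotient_object /= E.
  apply: (graded_slope_lt (b := cmap c' 0) _ _ sp sq uw' eq _ sq' _ des').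
    by rewrite -cincl_step.
  by have [] := c'ss 0 hi' Z' q' hq' lt0 sq'.
Qed.

End Existence.

(** * Uniqueness *)

Section Uniqueness.
Variables (R : realType) (C : exact_category) (A : arith_structure C).
Variables (dg : {additive arith_K0 A -> R}) (rk : rank_function C).
Variable X : arith_object A.
Local Notation sl := (slope dg rk).

(** Transitivity, with a cokernel chosen at each intermediate index. *)
Lemma HN_filtration_slope_lt (F : filtration X) j m (lt_j : (j < flen F)%N)
    (lt_m : (m < flen F)%N) (Qj Qm : arith_object A) :
  HN_filtration dg rk F -> (j < m)%N ->
  is_subquotient lt_j Qj -> is_subquotient lt_m Qm -> sl Qm < sl Qj.
Proof.
move=> [_ lt]; elim: m lt_m Qm => // m IH lt_m Qm.
rewrite ltnS leq_eqVlt => /orP[/eqP jm|ltjm] sj sm.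
  by subst m; apply: lt sj sm.
have lt_m' := ltnW lt_m.
have [Z [q sq]] := fmap_adm lt_m'.
have sQ : is_subquotient lt_m' (quotient_object (fsub lt_m') (ses_adm_epi sq)).
  by exists Z, q, (ses_adm_epi sq).
exact: lt_trans (lt _ _ _ _ _ sQ sm) (IH _ _ ltjm sj sQ).
Qed.

(** (A6) followed by (A3): G gets the same structure from Z inside X as from the subobject [QZ] of
    the quotient [QX]. *)
Lemma push_pull_noether (Z QZ QX G : C) (b : mor Z X) (pZ : mor Z QZ)
    (pX : mor X QX) (e : mor QZ QX) (s : mor QZ G) (r : mor Z G)
    (hb : adm_mono b) (hpX : adm_epi pX) (he : adm_mono e) (hpZ : adm_epi pZ)
    (hs : adm_epi s) (hr : adm_epi r) (h : A X) :
  cocartesian b pZ pX e -> s \oc pZ = r ->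
  push hs (pull he (push hpX h)) = push hr (pull hb h).
Proof.
move=> cc spZ; rewrite (pull_push_square hb he hpZ hpX (or_intror cc)).
exact/esym/push_compE.
Qed.

(* By (HN2) the destabilizing subobject D of X/X_j factors through X_m/X_j for
   m = n, n-1, ..., j+1. *)
Lemma destabilizing_descent (F : filtration X) j (Q D : C) (p : mor X Q)
    (d : mor D Q) (hp : adm_epi p) (hd : adm_mono d) :
  HN2 dg rk -> HN_filtration dg rk F -> ses (fincl F j) p ->
  @destabilizing _ _ _ dg rk (quotient_object X hp) D d hd ->
  (forall m (lt_m : (m < flen F)%N) Qm, (j < m)%N -> is_subquotient lt_m Qm ->
     sl Qm < sl (subobject (quotient_object X hp) hd)) ->
  forall m, (j < m)%N -> (m <= flen F)%N ->
  forall (a : mor (fobj F j) (fobj F m)) Z (q : mor (fobj F m) Z) (e : mor Z Q),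
    fincl F m \oc a = fincl F j -> ses a q -> e \oc q = p \oc fincl F m ->
    exists k : mor D Z, e \oc k = d.
Proof.
move=> H2 [ss _] sp des ltD m ltjm /subnKC; move: (flen F - m)%N => s.
(* Descending induction on [m]. For m = n the term is X itself, and the induced map [t] from Q to Z
   is a section of [e]. *)
elim: s m ltjm => [|s IH] m ltjm mn a Z q e ma sa eq.
  rewrite addn0 in mn.
  have [g [gf fg]] : is_iso (fincl F m).
    by rewrite mn fincl_last; exact: is_iso_eqmor.
  have [|t tp] := ses_desc (a := q \oc g) sp.
    by rewrite -ma mcompA -(mcompA _ g) gf mcompm1 (ses_comp0 sa).
  exists (t \oc d); rewrite mcompA.
  suff -> : e \oc t = idm Q by rewrite mcomp1m.
  by apply: (ses_epi sp); rewrite -mcompA tp mcompA eq -mcompA fg mcompm1 mcomp1m.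
have lt_m : (m < flen F)%N by rewrite -mn addnS ltnS leq_addr.
have step := fincl_step lt_m; have hm1 := fincl_adm lt_m.
have [G [r sr]] := fmap_adm lt_m.
have [Z' [q' sa']] : adm_mono (fmap F m \oc a).
  exact: adm_mono_comp (ses_adm_mono sa) (ses_adm_mono sr).
have ma' : fincl F m.+1 \oc (fmap F m \oc a) = fincl F j.
  by rewrite mcompA -step.
have [G' [r0 sr0]] := hm1.
have [|e' [r0' [e'q' _ se' cc]]] := noether sa' sr0 (pX := p); first by rewrite ma'.
have [eps [r' [epsq r'q' seps _]]] := noether sa sr sa'.
have [|k' e'k'] := IH m.+1 (ltnW ltjm) _ _ _ _ _ ma' sa' e'q'.
  by rewrite addSnnS.
have he' := ses_adm_mono se'; have hr' := ses_adm_epi seps.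
have hr := ses_adm_epi sr.
have E := push_pull_noether hm1 hp he' (ses_adm_epi sa') hr' hr (ah X) cc r'q'.
have sG : is_subquotient lt_m (quotient_object (fsub lt_m) hr).
  exists G, r, hr; split=> //.
(* The composite D -> X_{m+1}/X_j -> X_{m+1}/X_m joins semistable objects of decreasing slope, so
   (HN2) kills it and [k'] lifts to the kernel X_m/X_j. *)
have cpt := compatible_through hd he' hr' (push hp (ah X)) e'k'.
have r'k'0 : r' \oc k' = 0.
  apply: H2 cpt.
  - exact: (destabilizing_semistable des).
  - by rewrite E (Prop_irrelevance hm1 (fincl_adm lt_m)); exact: ss sG.
  - by rewrite E (Prop_irrelevance hm1 (fincl_adm lt_m)); exact: ltD sG.
have [k epsk] := ses_lift seps r'k'0; exists k.
rewrite -e'k' -epsk mcompA; congr (_ \oc k); apply: (ses_epi sa).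
by rewrite eq -mcompA epsq mcompA e'q' step mcompA.
Qed.

(** The two factorizations together say that X_{j+1} is the preimage of D. With G = X_{j+1}/X_j, the
    first comes from G lying in D by (HN1), the second from D lying in G by the descent. *)
Lemma HN_filtration_preimage (F : filtration X) j (Q D : C) (p : mor X Q)
    (d : mor D Q) (hp : adm_epi p) (hd : adm_mono d) :
  HN2 dg rk -> HN_filtration dg rk F -> (j < flen F)%N -> ses (fincl F j) p ->
  @destabilizing _ _ _ dg rk (quotient_object X hp) D d hd ->
  (exists f : mor (fobj F j.+1) D, d \oc f = p \oc fincl F j.+1) /\
  (forall T (a : mor T X) (b : mor T D), p \oc a = d \oc b ->
     exists t : mor T (fobj F j.+1), fincl F j.+1 \oc t = a).
Proof.
move=> H2 HNF lt_j sp des; have [ss _] := HNF.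
have step := fincl_step lt_j; have hj1 := fincl_adm lt_j.
have [G [r sr]] := fmap_adm lt_j; have hr := ses_adm_epi sr.
have [G' [c sc]] := hj1.
have [|e [c' [er c'p se cc]]] := noether sr sc (pX := p); first by rewrite -step.
have he := ses_adm_mono se.
have E := push_pull_noether hj1 hp he hr (adm_epi_idm G) hr (ah X) cc (mcomp1m r).
have sG : is_subquotient lt_j (quotient_object (fsub lt_j) hr).
  by exists G, r, hr.
have E' : quotient_object (fsub lt_j) hr = subobject (quotient_object X hp) he.
  rewrite /quotient_object /subobject /= (Prop_irrelevance (fincl_adm lt_j) hj1).
  by rewrite -E push_idm.
have [nD leD unD] := des.
have nG : nonzero G by have [] := ss _ _ _ sG.
have leGD := leD _ _ he nG.
have [|k ek] :=
  destabilizing_descent H2 HNF sp des _ (ltnSn j) lt_j (esym step) sr er.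
  move=> m lt_m Qm ltjm sm; apply: lt_le_trans leGD; rewrite -E'.
  exact: HN_filtration_slope_lt HNF ltjm sG sm.
have eqGD : sl (subobject (quotient_object X hp) he) =
            sl (subobject (quotient_object X hp) hd).
  (* With a strict inequality, (HN2) would kill [k] from D to G, hence also [d], although D is
     non-zero. *)
  apply/le_anti; rewrite leGD leNgt; apply/negP => ltGD.
  have cpt := compatible_through hd he (adm_epi_idm G) (push hp (ah X)) ek.
  suff k0 : k = 0.
    move/nonzeroE: nD; apply; apply: (adm_mono_inj hd).
    by rewrite mcompm1 mcompm0 -ek k0 mcompm0.
  rewrite -[k]mcomp1m; apply: H2 cpt.
  - exact: (destabilizing_semistable des).
  - by rewrite push_idm -[ArithObject _ _]E'; exact: ss sG.
  - by rewrite push_idm.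
have [f df] := unD _ _ he nG eqGD; split.
  by exists (f \oc r); rewrite mcompA df er.
move=> T a b pa; apply: (ses_lift sc).
rewrite -c'p -mcompA pa -ek -mcompA mcompA (ses_comp0 se).
exact: mcomp0m.
Qed.

(** If G stopped at j, then X_j -> X would be an isomorphism and the next subquotient of F would
    vanish, whereas semistable objects are non-zero. *)
Lemma HN_filtration_longer (F G : filtration X) j
    (phi : mor (fobj F j) (fobj G j)) :
  HN_filtration dg rk F -> (j < flen F)%N -> (j <= flen G)%N ->
  is_iso phi -> fincl G j \oc phi = fincl F j -> (j < flen G)%N.
Proof.
move=> [ss _] lt_j le_j isophi Gphi; rewrite ltn_neqAle le_j andbT.
apply/eqP => jn.
have [g [gf fg]] : is_iso (fincl F j).
  rewrite -Gphi; apply: is_iso_comp isophi _.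
  by rewrite jn fincl_last; exact: is_iso_eqmor.
have step := fincl_step lt_j.
have [Z [r sr]] := fmap_adm lt_j; have hr := ses_adm_epi sr.
have [] := ss j lt_j (quotient_object (fsub lt_j) hr).
  by exists Z, r, hr.
move=> nZ _; apply: (ses_iso_zero sr (s := g \oc fincl F j.+1)) nZ.
apply: (adm_mono_inj (fincl_adm lt_j)).
by rewrite mcompA -step mcompA fg mcomp1m mcompm1.
Qed.

(** Through [phi] both j-th terms have the same quotient of X, so both next terms are preimages of
    one destabilizing subobject. *)
Lemma HN_filtration_step (F G : filtration X) j
    (phi : mor (fobj F j) (fobj G j)) :
  Harder_Narasimhan_category dg rk ->
  HN_filtration dg rk F -> HN_filtration dg rk G ->
  (j < flen F)%N -> (j < flen G)%N ->
  is_iso phi -> fincl G j \oc phi = fincl F j ->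
  exists psi : mor (fobj F j.+1) (fobj G j.+1),
    is_iso psi /\ fincl G j.+1 \oc psi = fincl F j.+1.
Proof.
move=> [H1 H2] HF HG ltF ltG isophi Gphi.
have [Q [p sp]] := fincl_adm (ltnW ltF).
have spG : ses (fincl G j) p.
  apply: (ses_iso isophi (is_iso_idm _) (is_iso_idm _) _ _ sp).
    by rewrite Gphi mcomp1m.
  by rewrite mcompm1 mcomp1m.
have nQ : nonzero Q.
  (* If X/X_j vanished, so would X_{j+1}/X_j. *)
  move=> zQ; have isoG := ses_zero_iso spG (fun n => n zQ).
  have [ss _] := HF; have step := fincl_step ltF.
  have [Z [r sr]] := fmap_adm ltF; have hr := ses_adm_epi sr.
  have [] := ss j ltF (quotient_object (fsub ltF) hr).
    by exists Z, r, hr.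
  have [g [gf fg]] := ses_zero_iso sp (fun n => n zQ).
  move=> nZ _; apply: (ses_iso_zero sr (s := g \oc fincl F j.+1)) nZ.
  apply: (adm_mono_inj (fincl_adm ltF)).
  by rewrite mcompA -step mcompA fg mcomp1m mcompm1.
have hp := ses_adm_epi sp.
have [D [d [hd des]]] := destabilizing_exists H1 (X := quotient_object X hp) nQ.
have [[f df] uF] := HN_filtration_preimage H2 HF ltF sp des.
have [[g dg'] uG] := HN_filtration_preimage H2 HG ltG spG des.
have [s Gs] := uG _ _ _ (esym df); have [t Ft] := uF _ _ _ (esym dg').
exists s; split=> //; exists t; split.
  by apply: (adm_mono_inj (fincl_adm ltF)); rewrite mcompA Ft Gs mcompm1.
by apply: (adm_mono_inj (fincl_adm ltG)); rewrite mcompA Gs Ft mcompm1.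
Qed.

Lemma mor_from_zero_eq (Y Z : C) (f g : mor Y Z) : Y = zobj -> f = g.
Proof.
move=> e; move: f g; rewrite e => f g.
by rewrite (mor_from_zobj f) (mor_from_zobj g).
Qed.

Lemma HN_filtration_term_iso (F G : filtration X) :
  Harder_Narasimhan_category dg rk ->
  HN_filtration dg rk F -> HN_filtration dg rk G ->
  forall j, (j <= flen F)%N -> (j <= flen G)%N /\
    exists phi : mor (fobj F j) (fobj G j),
      is_iso phi /\ fincl G j \oc phi = fincl F j.
Proof.
move=> HN HF HG; elim=> [_|j IH ltF].
  split=> //; exists (eqmor (etrans (fobj_first F) (esym (fobj_first G)))).
  by split; [exact: is_iso_eqmor | apply/mor_from_zero_eq/fobj_first].
have [leG [phi [isophi Gphi]]] := IH (ltnW ltF).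
have ltG := HN_filtration_longer HF ltF leG isophi Gphi.
by split=> //; exact: HN_filtration_step HN HF HG ltF ltG isophi Gphi.
Qed.

Lemma HN_filtration_unique (F G : filtration X) :
  Harder_Narasimhan_category dg rk ->
  HN_filtration dg rk F -> HN_filtration dg rk G -> uniquely_isomorphic F G.
Proof.
move=> HN HF HG.
have FG := HN_filtration_term_iso HN HF HG.
have eqn : flen F = flen G.
  apply/eqP; rewrite eqn_leq (proj1 (FG _ (leqnn _))).
  by rewrite (proj1 (HN_filtration_term_iso HN HG HF (leqnn _))).
split=> //.
have ex i : exists phi : mor (fobj F i) (fobj G i),
    (i <= flen F)%N -> is_iso phi /\ fincl G i \oc phi = fincl F i.
  have [le_i|lt_i] := leqP i (flen F); last by exists 0.
  by have [_ [phi ?]] := FG i le_i; exists phi.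
(* Squares commute and components are unique because the inclusions into X are monomorphisms. *)
pose phi i := sval (cid (ex i)).
have phiP i : (i <= flen F)%N -> is_iso (phi i) /\ fincl G i \oc phi i = fincl F i.
  exact: svalP (cid (ex i)).
have incl_inj i T (s t : mor T (fobj G i)) : (i <= flen F)%N ->
    fincl G i \oc s = fincl G i \oc t -> s = t.
  by rewrite eqn => /fincl_adm; apply: adm_mono_inj.
exists phi; split.
  split=> [i /phiP[]|i lt_i|] //; last by case: (phiP (flen F)).
  apply: (incl_inj) => //.
  rewrite mcompA (proj2 (phiP _ lt_i)) mcompA -!fincl_step -?eqn //.
  by rewrite (proj2 (phiP _ (ltnW lt_i))).
move=> psi [_ psi_sq psi_last] i le_i; apply: incl_inj => //.
rewrite (proj2 (phiP _ le_i)).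
(* Descending from the last term, [psi] commutes with the inclusions into X. *)
move: le_i => /subnKC; move: (flen F - i)%N => s.
elim: s i => [|s IH] i; first by rewrite addn0 => ->.
move=> is_; have lt_i : (i < flen F)%N by rewrite -is_ addnS ltnS leq_addr.
rewrite (fincl_step lt_i) (@fincl_step _ _ G) -?eqn // -mcompA -psi_sq // mcompA.
by rewrite IH // addSnnS.
Qed.

End Uniqueness.

Theorem theorem4p3 (R : realType) (C : exact_category) (A : arith_structure C)
    (dg : {additive arith_K0 A -> R}) (rk : rank_function C)
    (HN : Harder_Narasimhan_category dg rk)
    (X : arith_object A) (X_neq0 : nonzero X) :
  (exists F : filtration X, HN_filtration dg rk F) /\
  (forall F G : filtration X,
     HN_filtration dg rk F -> HN_filtration dg rk G -> uniquely_isomorphic F G).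
Proof.
split=> [|F G]; last exact: HN_filtration_unique.
have [H1 _] := HN.
(* The construction starts from Y = 0, whose quotient is X. *)
have [|c [c0 cm ci css clt]] :=
  chain_exists H1 (n := `|rk (K0_of (aobj X))|%N) (ses_0idm X) X_neq0.
  by rewrite abszE ler_norm.
have [e cl] := cincl_last c.
exists (Filtration cm erefl cl (@cincl_step _ _ _ c)); split.
  by move=> j lt_j Q [Z [q [hq [sq ->]]]]; apply: css.
move=> j lt_j lt_j1 Q Q' [Z [q [hq [sq ->]]]] [Z' [q' [hq' [sq' ->]]]].
exact: clt.
Qed.
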